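(* Let $\Gamma$ be a (Gromov) hyperbolic group. Then the action of $\Gamma$ on its Gromov boundary $\partial\Gamma$ is tame but not tame$_{\mathbf 1}$.
   Context: A (Gromov) hyperbolic group is a finitely generated group $\Gamma$ whose Cayley graph with respect to a finite generating set is a Gromov hyperbolic metric space. Its Gromov boundary $\partial\Gamma$ is the compact metrizable space of equivalence classes of geodesic rays in the Cayley graph (two rays being equivalent if they stay at bounded distance from each other), on which $\Gamma$ acts by homeomorphisms. Write $X=\partial\Gamma$. The enveloping semigroup $E(X,\Gamma)$ is the closure of the set of translations $\{x\mapsto \gamma x:\gamma\in\Gamma\}$ in $X^X$ with the pointwise (product) topology. The system $(X,\Gamma)$ is tame$_{\mathbf 1}$ if $E(X,\Gamma)$ is first countable. A sequence $(f_n)$ of real functions on $X$ is independent if there are reals $a<b$ such that $\bigcap_{n\in P}f_n^{-1}((-\infty,a))\cap\bigcap_{n\in M}f_n^{-1}((b,\infty))\neq\emptyset$ for all finite disjoint $P,M\subset\mathbb N$. The system $(X,\Gamma)$ is tame if for every continuous $f\colon X\to\mathbb R$ the family $\{f\circ \gamma:\gamma\in \Gamma\}$ contains no infinite independent sequence.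
   Formalization: ''Not tame_1'' is proved for non-elementary Γ (∂Γ has at least three points); if ∂Γ has at most two points (e.g. Γ finite or Γ = ℤ), E(X,Γ) is finite and first countable, so that half of the claim fails. Tameness is proved for every hyperbolic Γ. *)

(* Defs.v *)
From HB Require Import structures.
From mathcomp Require Import all_boot all_order all_algebra generic_quotient.
From mathcomp Require Import all_classical all_reals all_analysis.
Import numFieldNormedType.Exports.

Set Implicit Arguments.
Unset Strict Implicit.
Unset Printing Implicit Defensive.

Import Order.TTheory GRing.Theory Num.Theory.
Local Open Scope classical_set_scope.
Local Open Scope quotient_scope.
Local Open Scope group_scope.

Section GromovHyperbolic.
Local Open Scope ring_scope.
Context {R : realType} {T : Type} (d : T -> T -> R).

Definition gromov_product (w x y : T) : R := (d x w + d y w - d x y) / 2.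

Definition gromov_hyperbolic : Prop :=
  exists delta : R, forall w x y z : T,
    gromov_product w x z >=
      Num.min (gromov_product w x y) (gromov_product w y z) - delta.

End GromovHyperbolic.

Definition generates (G : groupType) (S : seq G) : Prop :=
  forall H : {pred G}, group_closed H -> {subset S <= H} -> forall g, g \in H.

Section Cayley.
Context {G : groupType} (S : seq G).

Definition cayley_adj : rel G := fun x y => (x^-1 * y \in S) || (y^-1 * x \in S).

Definition cayley_walk (n : nat) (x y : G) : Prop :=
  exists p : seq G, [/\ path cayley_adj x p, last x p = y & size p = n].

Lemma cayley_adjC x y : cayley_adj x y = cayley_adj y x.
Proof. exact: orbC. Qed.

Lemma cayley_adjM g x y : cayley_adj (g * x) (g * y) = cayley_adj x y.
Proof. by rewrite /cayley_adj !invgM -!mulgA !mulKg. Qed.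

Lemma cayley_walk0 x : cayley_walk 0 x x.
Proof. by exists [::]. Qed.

Lemma cayley_walk_trans m n x y z :
  cayley_walk m x y -> cayley_walk n y z -> cayley_walk (m + n) x z.
Proof.
move=> [p [xp <- <-]] [q [pq <- <-]]; exists (p ++ q).
by rewrite cat_path xp pq last_cat size_cat.
Qed.

Lemma cayley_walk_sym n x y : cayley_walk n x y -> cayley_walk n y x.
Proof.
move=> [p [xp <- <-]]; exists (rev (belast x p)); split.
- by rewrite rev_path (eq_path (e' := cayley_adj)) // => u v; exact: cayley_adjC.
- by case: p xp => //= z p _; rewrite rev_cons last_rcons.
- by rewrite size_rev size_belast.
Qed.

Lemma cayley_walkM n g x y :
  cayley_walk n x y -> cayley_walk n (g * x) (g * y).
Proof.
move=> [p [xp <- <-]]; exists [seq g * z | z <- p]; split.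
- elim: p x xp => //= z p IHp x /andP[xz zp].
  by rewrite cayley_adjM xz IHp.
- by rewrite last_map.
- by rewrite size_map.
Qed.

Lemma cayley_walk_ex :
  generates S -> forall x y, exists n, `[< cayley_walk n x y >].
Proof.
move=> genS.
pose H : {pred G} := [pred g | `[< exists n, cayley_walk n 1 g >]].
have HP g : reflect (exists n, cayley_walk n 1 g) (g \in H).
  by rewrite inE; exact: asboolP.
have clH : group_closed H.
  split; first by apply/HP; exists 0%N; exact: cayley_walk0.
  move=> g h /HP[m wg] /HP[n wh]; apply/HP; exists (m + n)%N.
  apply: (cayley_walk_trans wg).
  have := cayley_walkM (g * h^-1) (cayley_walk_sym wh).
  by rewrite mulgVK mulg1.
have sSH : {subset S <= H}.
  move=> s sS; apply/HP; exists 1%N, [:: s]; split => //=.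
  by rewrite /cayley_adj invg1 mul1g sS.
move=> x y; have /HP[n w] := genS H clH sSH (x^-1 * y).
exists n; apply/asboolP.
by have := cayley_walkM x w; rewrite mulg1 mulVKg.
Qed.

End Cayley.

Section Boundary.
Context {G : groupType} {S : seq G} (genS : generates S).

(* The Cayley graph is represented by its vertex set with the path metric; its
   geometric realization lies within distance 1/2 of it, so hyperbolicity (up
   to the value of delta) and the classes of geodesic rays are the same. *)
Definition cayley_dist (x y : G) : nat := ex_minn (cayley_walk_ex genS x y).

Lemma cayley_dist_walk x y : cayley_walk S (cayley_dist x y) x y.
Proof. by rewrite /cayley_dist; case: ex_minnP => n /asboolP. Qed.

Lemma cayley_dist_le n x y : cayley_walk S n x y -> (cayley_dist x y <= n)%N.
Proof.
by rewrite /cayley_dist; case: ex_minnP => m _ h w; apply/h/asboolP.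
Qed.

Lemma cayley_distxx x : cayley_dist x x = 0%N.
Proof. by apply/eqP; rewrite -leqn0; exact/cayley_dist_le/cayley_walk0. Qed.

Lemma cayley_distC x y : cayley_dist x y = cayley_dist y x.
Proof.
by apply/eqP; rewrite eqn_leq; apply/andP; split;
  exact/cayley_dist_le/cayley_walk_sym/cayley_dist_walk.
Qed.

Lemma cayley_dist_triangle y x z :
  (cayley_dist x z <= cayley_dist x y + cayley_dist y z)%N.
Proof.
exact/cayley_dist_le/(cayley_walk_trans (cayley_dist_walk x y))/cayley_dist_walk.
Qed.

Lemma cayley_distM g x y : cayley_dist (g * x) (g * y) = cayley_dist x y.
Proof.
apply/eqP; rewrite eqn_leq; apply/andP; split; apply/cayley_dist_le.
  exact/cayley_walkM/cayley_dist_walk.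
by have := cayley_walkM g^-1 (cayley_dist_walk (g * x) (g * y)); rewrite !mulKg.
Qed.

Definition hyperbolic_group (R : realType) : Prop :=
  gromov_hyperbolic (fun x y : G => ((cayley_dist x y)%:R)%R : R).

(* Distinct vertices being at distance at least 1, pointwise convergence of rays
   nat -> G, for the discrete topology on G, is uniform convergence on compact
   sets. *)
Definition geodesic_rays : set {ptws nat -> discrete_topology G} :=
  [set r | forall i j : nat, (i <= j)%N -> cayley_dist (r i) (r j) = (j - i)%N].

Definition asymptotic (r s : geodesic_rays) : bool :=
  `[< exists C : nat, forall i, (cayley_dist (val r i) (val s i) <= C)%N >].

Lemma asymptotic_refl : reflexive asymptotic.
Proof. by move=> r; apply/asboolP; exists 0%N => i; rewrite cayley_distxx. Qed.

Lemma asymptotic_sym : symmetric asymptotic.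
Proof.
move=> r s; apply: asbool_equiv_eq; split=> -[C rs]; exists C => i;
  by rewrite cayley_distC.
Qed.

Lemma asymptotic_trans : transitive asymptotic.
Proof.
move=> s r t /asboolP[C rs] /asboolP[D st]; apply/asboolP; exists (C + D)%N => i.
exact: leq_trans (cayley_dist_triangle (val s i) _ _) (leq_add (rs i) (st i)).
Qed.

Canonical asymptotic_equiv :=
  EquivRel asymptotic asymptotic_refl asymptotic_sym asymptotic_trans.

(* The quotient of the space of all geodesic rays; for a hyperbolic group, it is
   homeomorphic to the quotient of the compact space of rays based at 1, which
   carries the usual compact metrizable topology. *)
Definition gromov_boundary : Type :=
  quotient_topology {eq_quot asymptotic_equiv}.

HB.instance Definition _ := Topological.on gromov_boundary.

Definition boundary_point (r : geodesic_rays) : gromov_boundary :=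
  (\pi_({eq_quot asymptotic_equiv}) r)%qT.

(* A hyperbolic group is elementary (finite or virtually infinite cyclic) if
   and only if its boundary has at most two points. *)
Definition non_elementary : Prop :=
  exists x y z : gromov_boundary, [/\ x <> y, y <> z & x <> z].

Lemma translate_subproof (g : G) (r : geodesic_rays) :
  ((fun i => g * val r i) : {ptws nat -> discrete_topology G}) \in geodesic_rays.
Proof.
apply/mem_set => i j ij /=; rewrite cayley_distM.
exact: (set_mem (valP r)).
Qed.

Definition translate (g : G) (r : geodesic_rays) : geodesic_rays :=
  exist (fun s => s \in geodesic_rays) _ (translate_subproof g r).

Definition boundary_act (g : G) (x : gromov_boundary) : gromov_boundary :=
  boundary_point (translate g (repr x)).

Lemma boundary_actE g r :
  boundary_act g (boundary_point r) = boundary_point (translate g r).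
Proof.
apply/eqmodP/asboolP.
have /eqmodP/asboolP[C rC] :
  (repr (boundary_point r) = r %[mod {eq_quot asymptotic_equiv}])%qT.
  exact: reprK.
by exists C => i; rewrite /= cayley_distM; exact: rC.
Qed.

End Boundary.

Arguments boundary_act {G S} genS g x.

Section Dynamics.
Context {G : groupType} {X : topologicalType} (act : G -> X -> X).

Definition enveloping_semigroup : set {ptws X -> X} :=
  closure ([set act g | g in [set: G]] : set {ptws X -> X}).

Definition first_countable (T : topologicalType) : Prop :=
  forall x : T, exists U : nat -> set T,
    (forall n, nbhs x (U n)) /\ (forall V, nbhs x V -> exists n, U n `<=` V).

Definition tame1 : Prop := first_countable enveloping_semigroup.

Definition independent (R : realType) (f : nat -> X -> R) : Prop :=
  exists a b : R, (a < b)%R /\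
    forall P M : set nat, finite_set P -> finite_set M -> P `&` M = set0 ->
      (\bigcap_(n in P) (f n @^-1` [set y | (y < a)%R])) `&`
      (\bigcap_(n in M) (f n @^-1` [set y | (b < y)%R])) !=set0.

Definition tame (R : realType) : Prop :=
  forall f : X -> R, continuous f ->
    ~ exists h : nat -> X -> R,
        (forall n, exists g : G, h n = f \o act g) /\ independent h.

End Dynamics.

(* Main.v *)
Require Import Defs.
From HB Require Import structures.
From mathcomp Require Import all_boot all_order all_algebra.
From mathcomp Require Import all_classical all_reals all_analysis.
From mathcomp Require Import zify lra.

(** Why the theorem is true.

    Everything dynamical follows from one property, of convergence-group type.
    A family of group elements, directed by a filter [U], collapses the space
    to [a] away from [b] when [x |-> g x] tends to [a] along [U], uniformly
    outside each neighbourhood of [b] ([collapses]).  On the boundary of a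
    hyperbolic group, every injective sequence of group elements collapses
    along some finer filter ([injective_sequence_collapses]), and every
    boundary point [z] is the attracting point [a] of some collapse
    ([attracted_everywhere]): follow a ray towards [z].

    Tameness ([convergence_action_tame]).  Let the functions [f o g_n] be
    independent with thresholds [lo < hi].  Refine to a collapse with points
    [a], [b].  One of the two conditions [f < lo], [f > hi] fails near [a], so
    for large [n] it can hold at [g_n x] only for [x] near [b].  By
    independence this condition at index [n] is compatible with each of the two
    conditions at index [0]; hence [f o g_0] takes values below [lo] and values
    above [hi] arbitrarily close to [b], against its continuity.

    Failure of first countability ([convergence_action_not_tame1]).  Let [b] be
    a point whose orbit is not too small, and [e] the repelling point of a
    collapse attracted by [b].  Inverting this collapse and precomposing by
    translations gives collapses attracted by [e] and repelled by any point of
    the orbit of [b], which accumulates at each of its points.  So the constant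
    map [e] lies in the enveloping semigroup.  A countable base at it is
    defeated by a diagonal argument: choose [g_n] in its [n]-th member and,
    using compactness, one point [c] that no [g_n] sends close to [e].  Three
    boundary points are used only to find [b]: otherwise there would be an
    invariant pair of points, and a collapse attracted by a third point forbids
    it.

    Geometry.  The only consequence of hyperbolicity in use is the four-point
    inequality on integer distances.  Compactness arguments are made with
    ultrafilters instead of subsequences: balls being finite, any family of
    geodesics from [1] has a coordinatewise limit along an ultrafilter
    ([ultralimit_ray]).  If [g] tends to infinity along [U], let [a] and [b] be
    the limits of segments from [1] to [g] and to [g^-1].  A ray from [1] that
    leaves the segment to [g^-1] at a bounded time is sent by [g] to a ray from
    [g] that soon diverges from the segment back to [1]; seen from [1], it
    follows the segment to [g] for a long time ([far_ray_follows]).  This is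
    the collapse, to [a] away from [b] ([collapses_of_segments]). *)

Set Implicit Arguments.
Unset Strict Implicit.
Unset Printing Implicit Defensive.

Import Order.TTheory GRing.Theory Num.Theory.
Import numFieldNormedType.Exports.
Local Open Scope classical_set_scope.
Local Open Scope group_scope.

(** * Filters and pointwise convergence *)

Lemma ptws_cvg (I : Type) (V : topologicalType) (F : set_system {ptws I -> V})
    (f : {ptws I -> V}) :
  Filter F -> (forall t, (fun h : {ptws I -> V} => h t) @ F --> f t) -> F --> f.
Proof.
move=> FF Ff; apply/cvg_sup => i; apply/cvg_image.
  by rewrite eqEsubset; split=> v // _; exists (fun=> v).
move=> W /Ff /= FW; rewrite nbhs_simpl /=; exists ((fun h => h i) @^-1` W) => //.
by rewrite eqEsubset; split => [v [h ? <-//]|v Wv]; exists (fun=> v).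
Qed.

(** The sets on the right generate a filter that converges pointwise to the
    constant map, so every neighbourhood belongs to this filter. *)
Lemma ptws_nbhs_cst (I : choiceType) (V : topologicalType) (e : V)
    (A : set {ptws I -> V}) :
  nbhs ((fun=> e) : {ptws I -> V}) A ->
  exists F : seq I, exists2 W, nbhs e W &
    forall h : I -> V, (forall x, x \in F -> W (h x)) -> A h.
Proof.
pose B (FW : seq I * set V) : set {ptws I -> V} :=
  [set h | forall x, x \in FW.1 -> FW.2 (h x)].
pose D : set (seq I * set V) := [set FW | nbhs e FW.2].
have FD : Filter (filter_from D B).
  apply: filter_from_filter; first by exists ([::], setT) => //; exact: filterT.
  move=> [F W] [F' W'] /= eW eW'; exists (F ++ F', W `&` W'); first exact: filterI.
  move=> h hFW; split=> x xF /=; have [|//] := hFW x;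
    by rewrite mem_cat xF ?orbT.
have /(_ A) DA : filter_from D B --> ((fun=> e) : {ptws I -> V}).
  apply: ptws_cvg => t W eW; exists ([:: t], W) => //= h /(_ t).
  by apply; rewrite inE.
by move=> /DA[[F W] eW FWA]; exists F, W.
Qed.

Lemma proper_meets T (U : set_system T) {PU : ProperFilter U} (A B : set T) :
  U A -> U B -> exists x, A x /\ B x.
Proof. by move=> UA UB; apply: (@filter_ex _ U); exact: filterI. Qed.

(** The compactness principle behind all limits of geodesics: along an
    ultrafilter, a function with finitely many values is almost constant. *)
Lemma ultra_finite (T : Type) (K : eqType) (U : set_system T) (f : T -> K) (s : seq K) :
  UltraFilter U -> U [set t | f t \in s] -> exists c, U [set t | f t = c].
Proof.
move=> UU; elim: s => [|c s IHs] Us.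
  by have [] := @filter_ex _ U _ _ Us.
have [Uc|Uc] := in_ultra_setVsetC [set t | f t = c] UU; first by exists c.
apply: IHs; apply: (filterS _ (filterI Us Uc)) => t /= [].
by rewrite inE => /orP[/eqP|].
Qed.

(** * Collapsing families in a group action *)

Section ConvergenceAction.
Context {G : groupType} {X : topologicalType} (act : G -> X -> X).

(** Filters on [G] are allowed, instead of sequences, because limits are taken
    along ultrafilters.  The condition is symmetric under inversion: [g] maps
    the complement of [V] into [W] exactly when [g^-1] maps the complement of
    [W] into [V]. *)
Definition collapses (U : set_system G) (a b : X) : Prop :=
  forall W V, nbhs a W -> nbhs b V ->
    U [set g | forall x, ~ V x -> W (act g x)].

Section Tame.
Local Open Scope ring_scope.
Context {R : realType}.

Definition beyond (s : bool) (lo hi : R) : set R :=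
  if s then [set y | y < lo] else [set y | hi < y].

(** Tameness needs independence only for pairs of indices, the index [0]
    being one of them. *)
Lemma independent_pair (h : nat -> X -> R) lo hi (s t : bool) n :
  (forall P M : set nat, finite_set P -> finite_set M -> P `&` M = set0 ->
      (\bigcap_(n in P) (h n @^-1` [set y | (y < lo)%R])) `&`
      (\bigcap_(n in M) (h n @^-1` [set y | (hi < y)%R])) !=set0) ->
  (0 < n)%N -> exists x, beyond s lo hi (h 0%N x) /\ beyond t lo hi (h n x).
Proof.
move=> ind n0.
pose S b : set nat := [set k | k = 0%N /\ s = b] `|` [set k | k = n /\ t = b].
have finS b : finite_set (S b).
  apply: (@sub_finite_set _ _ [set 0%N; n]); last exact: finite_set2.
  by move=> k [] [-> _]; [left|right].
have [|x [xP xM]] := ind (S true) (S false) (finS _) (finS _).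
  rewrite -subset0 => k [[] [kE sE] [] [kE' sE']].
  - by rewrite sE in sE'.
  - by rewrite -kE' kE in n0.
  - by rewrite -kE kE' in n0.
  - by rewrite sE in sE'.
exists x; split.
  by case: s @S finS xP xM => S _ xP xM; [apply: xP | apply: xM]; left.
by case: t @S finS xP xM => S _ xP xM; [apply: xP | apply: xM]; right.
Qed.

(** The sublevel or superlevel sets of [f o g_n] that stay away from the
    attracting point shrink to the repelling point [b], yet by independence they
    meet both a sublevel and a superlevel set of the single function [f o g_0],
    which cannot oscillate at [b]. *)
Lemma convergence_action_tame :
  (forall g, continuous (act g)) ->
  (forall g : nat -> G, injective g -> exists U a b,
     [/\ ProperFilter U, g @ \oo `<=` U & collapses U a b]) ->
  tame act R.
Proof.
move=> ctact conv f ctf [h [hact [lo [hi [lohi ind]]]]].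
have /choice[g hg] := hact.
have ginj : injective g.
  move=> i j gij; apply: contrapT => /eqP nij.
  have [|x [/(_ i erefl)/= hi1 /(_ j erefl)/= hj1]] :=
    ind [set i] [set j] (finite_set1 _) (finite_set1 _).
    by rewrite -subset0 => k [-> /eqP]; rewrite (negbTE nij).
  have hij : h i = h j by rewrite !hg gij.
  by move: (lt_trans lohi hj1); rewrite -hij ltNge (ltW hi1).
have [U [a [b [PU gU Uab]]]] := conv g ginj.
have ctf0 : continuous (h 0%N).
  by rewrite hg => x; apply: continuous_comp; [exact: ctact|exact: ctf].
(* [t] is a side of the thresholds on which [f] does not fall near [a]. *)
have [t nt] : exists t, nbhs a [set x | ~ beyond t lo hi (f x)].
  case: (leP (f a) lo) => [fa|fa].
    exists false; apply: (@filterS _ _ _ (f @^-1` [set y | y < hi])).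
      by move=> x /= fx; apply/negP; rewrite -leNgt ltW.
    exact/ctf/lt_nbhsl/(le_lt_trans fa lohi).
  exists true; apply: (@filterS _ _ _ (f @^-1` [set y | lo < y])).
    by move=> x /= fx; apply/negP; rewrite -leNgt ltW.
  exact/ctf/lt_nbhsr.
have near_b s V : nbhs b V -> exists2 x, V x & beyond s lo hi (h 0%N x).
  move=> bV; have Upos : U [set u | exists2 n, (0 < n)%N & u = g n].
    apply: gU; rewrite /fmap /=; near=> n; exists n => //.
    by near: n; exact: nbhs_infty_gt.
  have [u [/= uW [n n0 ue]]] := proper_meets (Uab _ _ nt bV) Upos.
  rewrite {u}ue in uW.
  have [x [x0 xn]] := independent_pair s t ind n0.
  exists x => //; apply: contrapT => /uW; apply.
  by move: xn; rewrite hg.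
case: (ltP (h 0%N b) hi) => [hb|hb].
  have [|x /= xhi /(lt_trans xhi)] := near_b false (h 0%N @^-1` [set y | y < hi]).
    exact/ctf0/lt_nbhsl.
  by rewrite ltxx.
have [|x /= xlo xlo'] := near_b true (h 0%N @^-1` [set y | lo < y]).
  exact/ctf0/lt_nbhsr/(lt_le_trans lohi).
by have := lt_trans xlo xlo'; rewrite ltxx.
Unshelve. all: by end_near. Qed.

End Tame.

Section NotTame1.
Hypotheses (hX : hausdorff_space X) (cX : compact [set: X])
  (act1 : forall x, act 1 x = x)
  (actM : forall g k x, act (g * k) x = act g (act k x))
  (ctact : forall g, continuous (act g))
  (conv : forall z, exists (U : set_system G) e, ProperFilter U /\ collapses U z e).

Let actK g x : act g^-1 (act g x) = x.
Proof. by rewrite -actM mulVg act1. Qed.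

Let actVK g x : act g (act g^-1 x) = x.
Proof. by rewrite -actM mulgV act1. Qed.

Let nbhs_act g x (A : set X) : nbhs (act g x) A -> nbhs x (act g @^-1` A).
Proof. by move=> nA; exact: (ctact nA). Qed.

Let sep (x y : X) : x <> y ->
  exists U V : set X, [/\ open U, open V, U x, V y & U `&` V = set0].
Proof.
move=> /eqP xy; move: hX; rewrite open_hausdorff.
move=> /(_ _ _ xy)[[U V] /= [xU yV] [oU oV UV]].
by exists U, V; split=> //; [exact: set_mem|exact: set_mem|exact/eqP].
Qed.

Let closed_seq (F : seq X) : closed [set` F].
Proof.
apply: (accessible_finite_set_closed.1 (hausdorff_accessible hX)).
exact: finite_seq.
Qed.

Let nbhs_neq (x y : X) : x <> y -> nbhs x [set z | z <> y].
Proof.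
move=> xy; have [U [V [oU oV Ux Vy UV]]] := sep xy.
apply: (filterS _ (open_nbhs_nbhs (conj oU Ux))) => z Uz zy.
by rewrite -[False]/(set0 z) -UV; split=> //; rewrite zy.
Qed.

(** A collapse attracted by [z] sends whichever of [p], [q] is not the
    repelling point close to [z], out of the pair. *)
Lemma no_invariant_pair p q z : p <> q -> z <> p -> z <> q ->
  (forall g, act g p = p \/ act g p = q) ->
  (forall g, act g q = p \/ act g q = q) -> False.
Proof.
move=> pq zp zq gp gq; have [U [e [PU Uze]]] := conv z.
have main r : r <> e -> (forall g, act g r = p \/ act g r = q) -> False.
  move=> re gr.
  have zW : nbhs z ([set w | w <> p] `&` [set w | w <> q]).
    by apply: filterI; exact: nbhs_neq.
  have /filter_ex[g /= gW] := Uze _ _ zW (nbhs_neq (nesym re)).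
  by have [] := gW r; [exact|case: (gr g)].
have [pe|pe] := pselect (p = e); last exact: main pe gp.
by apply: main gq; rewrite -pe => /esym.
Qed.

(** An orbit with exactly two points would be an invariant pair, and so would
    be any two fixed points. *)
Lemma exists_large_orbit (x1 x2 x3 : X) : x1 <> x2 -> x2 <> x3 -> x1 <> x3 ->
  exists b g1 g2, [/\ b <> act g1 b, b <> act g2 b & act g1 b <> act g2 b].
Proof.
move=> x12 x23 x13; apply: contrapT => no.
have orb b g1 g : b <> act g1 b -> act g b = b \/ act g b = act g1 b.
  move=> bg1; apply: contrapT => /not_orP[gb gg1]; apply: no.
  by exists b, g1, g; split=> //; apply: nesym.
have [[b [g1 bg1]]|fixall] := pselect (exists b g1, b <> act g1 b); last first.
  have fix_ x g : act g x = x.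
    by apply: contrapT => gx; apply: fixall; exists x, g => /esym.
  by apply: (@no_invariant_pair x1 x2 x3 x12 (nesym x13) (nesym x23)) => g;
    rewrite fix_; auto.
have [z [zb zg1]] : exists z, z <> b /\ z <> act g1 b.
  apply: contrapT => noz.
  have two x : x = b \/ x = act g1 b.
    by apply: contrapT => /not_orP xx; apply: noz; exists x.
  by case: (two x1) => e1; case: (two x2) => e2; case: (two x3) => e3; congruence.
apply: (no_invariant_pair bg1 zb zg1) => g; first exact: orb.
by rewrite -actM; exact: orb.
Qed.

(** The collapse below is attracted by [b] and repelled by [e]; its inverse is
    attracted by [e] and repelled by [b].  The points [k1 b] and [k2 b] witness
    that the orbit of [b] does not reduce to [e] and one other point. *)
Section RepellingOrbit.
Variables (U : set_system G) (b e : X) (k1 k2 : G).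
Hypotheses (PU : ProperFilter U) (Ube : collapses U b e)
  (k1e : act k1 b <> e) (k2e : act k2 b <> e) (k12 : act k1 b <> act k2 b).

(** The collapse brings both [k1 b] and [k2 b] close to [b]; as these stay
    distinct, they do not both land on [b], so one of them gives an orbit point
    near [b] but different from it. *)
Lemma orbit_limit_point (F : seq X) (g : G) (O : set X) :
  open O -> O (act g b) -> exists g', O (act g' b) /\ act g' b \notin F.
Proof.
move=> oO Ogb.
(* Membership in [F] is only forbidden to points other than [b]: this is a
   neighbourhood of [b] even if [g b] belongs to [F]. *)
have bO : nbhs b [set x | O (act g x) /\ (act g x \in F -> x = b)].
  apply: filterI.
    by apply: (nbhs_act (A := O)); exact: open_nbhs_nbhs.
  have : nbhs b (act g @^-1` ~` [set` [seq y <- F | y != act g b]]).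
    apply: nbhs_act; apply: open_nbhs_nbhs; split.
      by apply: closed_openC; exact: closed_seq.
    by rewrite /= mem_filter eqxx.
  apply: filterS => x /= /negP xF xgF; apply: contrapT => xb; move/negP: xF; apply.
  rewrite mem_filter xgF andbT; apply/eqP => /(congr1 (act g^-1)).
  by rewrite !actK.
have eV : nbhs e ([set w | w <> act k1 b] `&` [set w | w <> act k2 b]).
  by apply: filterI; apply: nbhs_neq; exact: nesym.
have /filter_ex[u /= uO] := Ube bO eV.
have [Ou1 uF1] : O (act g (act u (act k1 b))) /\
   (act g (act u (act k1 b)) \in F -> act u (act k1 b) = b) by apply: uO => -[].
have [Ou2 uF2] : O (act g (act u (act k2 b))) /\
   (act g (act u (act k2 b)) \in F -> act u (act k2 b) = b) by apply: uO => -[].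
have [k1F|k1F] := boolP (act g (act u (act k1 b)) \in F); last first.
  by exists (g * u * k1); rewrite !actM.
have [k2F|k2F] := boolP (act g (act u (act k2 b)) \in F); last first.
  by exists (g * u * k2); rewrite !actM.
have ku : act u (act k1 b) = act u (act k2 b) by rewrite (uF1 k1F) (uF2 k2F).
by have := congr1 (act u^-1) ku; rewrite !actK.
Qed.

(** The step of the diagonal construction.  Repel from an orbit point [g0 b]
    of [O] outside the finite set [F] that controls [A]: then [u] sends all of
    [F] close to [e], while its inverse brings the point [k1 b] of [Y] back into
    [O]; this preimage is the new orbit point. *)
Lemma collapse_step (A : set {ptws X -> X}) (O Y : set X) (g : G) :
  nbhs ((fun=> e) : {ptws X -> X}) A -> open O -> O (act g b) -> Y (act k1 b) ->
  exists u g', [/\ A (act u), O (act g' b) & Y (act u (act g' b))].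
Proof.
move=> /ptws_nbhs_cst[F [W eW WA]] oO Ogb Yk1.
have [g0 [Og0 Fg0]] := orbit_limit_point F oO Ogb.
have bV : nbhs b (act g0 @^-1` (O `&` ~` [set` F])).
  apply: nbhs_act; apply: open_nbhs_nbhs; split; last by split=> //; exact/negP.
  by apply: openI => //; apply: closed_openC; exact: closed_seq.
have eV : nbhs e (W `&` [set w | w <> act k1 b]).
  by apply: filterI => //; apply: nbhs_neq; exact: nesym.
have /filter_ex[u /= uV] := Ube bV eV.
exists (u^-1 * g0^-1), (g0 * u * k1); split.
- apply: WA => x xF; rewrite actM; apply: contrapT => nW.
  have [|_] := uV (act u^-1 (act g0^-1 x)); first by case.
  by rewrite !actVK /=.
- by rewrite !actM; have [] : (O `&` ~` [set` F]) (act g0 (act u (act k1 b)))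
    by apply: uV => -[].
- by rewrite !actM !actK.
Qed.

Lemma cst_in_envelope : enveloping_semigroup act (fun=> e).
Proof.
move=> A eA.
have [u [_ [Au _ _]]] := collapse_step (O := setT) (Y := setT) (g := 1) eA openT I I.
by exists (act u); split => //; exists u.
Qed.

(** Nested open sets around orbit points, each mapped into [Y] by the next
    [u n]; a cluster point [c] of these orbit points is mapped by every [u n]
    into the closure of [Y], hence outside the neighbourhood [W] of [e], disjoint
    from [Y]. *)
Lemma collapse_sequence (A : nat -> set {ptws X -> X}) :
  (forall n, nbhs ((fun=> e) : {ptws X -> X}) (A n)) ->
  exists W c (u : nat -> G), [/\ nbhs e W, forall n, A n (act (u n)) &
    forall n, ~ W (act (u n) c)].
Proof.
move=> eA; have [Y [W [oY oW Yk We YW]]] := sep k1e.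
pose T := {Og : set X * G | open Og.1 /\ Og.1 (act Og.2 b)}.
have step (n : nat) (t : T) : exists ut : G * T,
   [/\ A n (act ut.1), (sval ut.2).1 `<=` (sval t).1 &
       forall x, (sval ut.2).1 x -> Y (act ut.1 x)].
  case: t => -[Q g] /= [oQ Qg].
  have [u [g' [Au Qg' Yg']]] := collapse_step (eA n) oQ Qg Yk.
  have oQ' : open (Q `&` act u @^-1` Y).
    by apply: openI => //; apply: open_comp => // x _; exact: ctact.
  exists (u, exist _ (Q `&` act u @^-1` Y, g') (conj oQ' (conj Qg' Yg'))).
  by split=> //= x [].
have /choice[f fP] : forall nt : nat * T, exists ut : G * T,
   [/\ A nt.1 (act ut.1), (sval ut.2).1 `<=` (sval nt.2).1 &
       forall x, (sval ut.2).1 x -> Y (act ut.1 x)].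
  by move=> [n t]; exact: step.
pose t0 : T := exist _ (setT, 1) (conj openT I).
pose fix st n : T := if n is m.+1 then (f (m, st m)).2 else t0.
pose u n := (f (n, st n)).1; pose O n := (sval (st n)).1.
pose y n := act (sval (st n)).2 b.
have Oy n : O n (y n) by exact: (svalP (st n)).2.
have Odecr m n : (m <= n)%N -> O n `<=` O m.
  elim: n => [|n IHn]; first by rewrite leqn0 => /eqP ->.
  rewrite leq_eqVlt => /predU1P[->//|/IHn mn]; apply: subset_trans mn.
  by have [] := fP (n, st n).
have [c [_ yc]] := cX (fmap_proper_filter y _ : ProperFilter (y @ \oo)) filterT.
exists W, c, u; split=> [|n|n Wc]; first exact: open_nbhs_nbhs.
  by have [] := fP (n, st n).
have [||x [yx Wx]] := yc (O n.+1) (act (u n) @^-1` W).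
- by exists n.+1 => // m /= nm; apply: (Odecr _ _ nm); exact: Oy.
- by apply: (nbhs_act (A := W)); apply: open_nbhs_nbhs; split.
have [_ _ /(_ _ yx) Yx] := fP (n, st n).
by rewrite -[False]/(set0 (act (u n) x)) -YW.
Qed.

End RepellingOrbit.

(** If the sets [B n] were a base at the constant map [e], one of them would
    lie in the neighbourhood of maps sending [c] into [W]; but [B n] contains
    the translation by [u n], which does not send [c] into [W]. *)
Lemma convergence_action_not_tame1 (x1 x2 x3 : X) :
  x1 <> x2 -> x2 <> x3 -> x1 <> x3 -> ~ tame1 act.
Proof.
move=> x12 x23 x13 fc.
have [b [g1 [g2 [b1 b2 g12]]]] := exists_large_orbit x12 x23 x13.
have [U [e [PU Ube]]] := conv b.
have [k1 [k2 [k1e k2e k12]]] : exists k1 k2,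
    [/\ act k1 b <> e, act k2 b <> e & act k1 b <> act k2 b].
  have [be|be] := pselect (b = e).
    by exists g1, g2; rewrite -be; split=> //; exact: nesym.
  have [ge|ge] := pselect (act g1 b = e).
    by exists 1, g2; rewrite act1; split=> // g2e; apply: g12; rewrite ge g2e.
  by exists 1, g1; rewrite act1.
have eE := cst_in_envelope PU Ube k1e k2e k12.
pose E := enveloping_semigroup act.
pose pt (p : {ptws X -> X}) (Ep : E p) : E :=
  exist (fun q => q \in E) p (mem_set Ep).
have [B [nB sB]] := fc (pt _ eE).
have /choice[A hA] : forall n, exists A : set {ptws X -> X},
    nbhs ((fun=> e) : {ptws X -> X}) A /\ forall p : E, A (val p) -> B n p.
  move=> n; have [_ [[A oA <-] Ae AB]] := nB n.
  by exists A; split=> //; exact: open_nbhs_nbhs.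
have [W [c [u [eW Au Wu]]]] :=
  collapse_sequence PU Ube k1e k2e k12 (fun n => (hA n).1).
have : nbhs (pt _ eE) [set p : E | W ((val p : {ptws X -> X}) c)].
  have eW' : nbhs ((fun=> e) : {ptws X -> X}) [set p | W (p c)].
    exact: (@proj_continuous X (fun=> X) c).
  exact: (@initial_continuous _ _ (val : E -> {ptws X -> X}) (pt _ eE) _ eW').
move=> /sB[n Bn]; have uE : E (act (u n)).
  by apply: subset_closure; exists (u n).
exact: (Wu n (Bn (pt _ uE) ((hA n).2 (pt _ uE) (Au n)))).
Qed.

End NotTame1.
End ConvergenceAction.

(** * Geodesics and rays in a Cayley graph *)

Section Cayley.
Context {G : groupType} {S : seq G} (genS : generates S).
Local Notation d := (cayley_dist genS).

Lemma path_walk (x : G) (p : seq G) i j : path (cayley_adj S) x p ->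
  (i <= j)%N -> (j <= size p)%N ->
  cayley_walk S (j - i)%N (nth 1 (x :: p) i) (nth 1 (x :: p) j).
Proof.
elim: p x i j => [|y p IHp] x i j /=.
  move=> _ ij; rewrite leqn0 => /eqP j0; move: ij; rewrite j0 leqn0 => /eqP->.
  exact: cayley_walk0.
move=> /andP[xy yp]; case: j => [|j].
  by rewrite leqn0 => /eqP-> _; exact: cayley_walk0.
case: i => [_ jp|i ij jp]; last by rewrite subSS; exact: IHp.
rewrite subn0 -[j.+1]/(1 + j)%N; apply: (@cayley_walk_trans _ _ _ _ _ y).
  by exists [:: y]; rewrite /= xy.
by have := IHp y 0%N j yp (leq0n j) jp; rewrite subn0.
Qed.

Definition geodesic_upto (n : nat) (c : nat -> G) : Prop :=
  forall i j, (i <= j <= n)%N -> d (c i) (c j) = (j - i)%N.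

Definition segment_to (g : G) (c : nat -> G) : Prop :=
  [/\ c 0%N = 1, c (d 1 g) = g & geodesic_upto (d 1 g) c].

Lemma segment_dist g c i : segment_to g c -> (i <= d 1%g g)%N ->
  d 1 (c i) = i /\ d (c i) g = (d 1%g g - i)%N.
Proof.
move=> [c0 cg gc] ig; split; first by rewrite -c0 gc ?subn0.
by rewrite -[X in d (c i) X]cg gc // ig leqnn.
Qed.

Lemma segment_ex (g : G) : exists c, segment_to g c.
Proof.
case: (cayley_dist_walk genS 1 g) => p [pp pg pn].
pose c := nth 1 (1 :: p).
have c_end : c (d 1 g) = g by rewrite -pn /c -last_nth.
have le_sub i j : (i <= j)%N -> (j <= d 1%g g)%N -> (d (c i) (c j) <= j - i)%N.
  by move=> ij jn; apply: cayley_dist_le; apply: path_walk => //; rewrite pn.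
exists c; split=> // i j /andP[ij jn]; apply/eqP; rewrite eqn_leq le_sub //=.
have := le_sub 0%N i (leq0n i) (leq_trans ij jn).
have := le_sub j (d 1 g) jn (leqnn _).
have := cayley_dist_triangle genS (c i) 1 g.
have := cayley_dist_triangle genS (c j) (c i) g.
by rewrite c_end -[c 0%N]/(1 : G); lia.
Qed.

Lemma ball_finite n : exists s : seq G, forall g, (d 1 g <= n)%N -> g \in s.
Proof.
suff [s sP] : exists s : seq G, forall m g, (m <= n)%N -> cayley_walk S m 1 g -> g \in s.
  by exists s => g gn; apply: sP gn _; exact: cayley_dist_walk.
elim: n => [|n [s sP]].
  exists [:: 1] => m g; rewrite leqn0 => /eqP-> [p [_ <- /size0nil->]].
  by rewrite inE.
exists (s ++ [seq x * a | x <- s, a <- S] ++ [seq x * a^-1 | x <- s, a <- S]).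
move=> m g; rewrite !mem_cat leq_eqVlt ltnS => /predU1P[->|mn]; last by move=> /sP ->.
move=> [p]; case/lastP: p => [|p y] [] //.
rewrite rcons_path last_rcons size_rcons => /andP[pp py] <- [pn].
have xs : last 1 p \in s by apply: (sP n) => //; exists p.
apply/orP; right; move: py; rewrite /cayley_adj => /orP[] aS; apply/orP; [left|right].
  by apply/allpairsP; exists (last 1 p, (last 1 p)^-1 * y); rewrite /= mulVKg.
by apply/allpairsP; exists (last 1 p, y^-1 * last 1 p); rewrite /= invgM invgK mulVKg.
Qed.

(** Restores the type [G], which the topology of rays hides behind its
    discrete copy. *)
Definition vertex (r : geodesic_rays genS) (i : nat) : G := val r i.

Lemma vertex_dist r i j : (i <= j)%N -> d (vertex r i) (vertex r j) = (j - i)%N.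
Proof. exact: (set_mem (valP r)). Qed.

Lemma ray_of (c : nat -> G) : (forall n, geodesic_upto n c) ->
  exists r, vertex r =1 c.
Proof.
move=> gc; have cr : (c : {ptws nat -> discrete_topology G}) \in geodesic_rays genS.
  by apply/mem_set => i j ij; apply: (gc j); rewrite ij leqnn.
by exists (exist (fun s => s \in geodesic_rays genS) _ cr).
Qed.

Lemma vertex_translate g r i : vertex (translate g r) i = g * vertex r i.
Proof. by []. Qed.

Definition based (r : geodesic_rays genS) : Prop := vertex r 0 = 1.

Lemma based_dist r i : based r -> d 1 (vertex r i) = i.
Proof. by move=> r0; have := @vertex_dist r 0%N i isT; rewrite r0 subn0. Qed.

(** The segments may be finite, as long as their lengths tend to infinity
    along [U]; each vertex of the limit is attained by almost all of them. *)
Lemma ultralimit_ray (T : Type) (U : set_system T) (c : T -> nat -> G) :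
  UltraFilter U ->
  (forall n, U [set t | c t 0%N = 1 /\ geodesic_upto n (c t)]) ->
  exists r, based r /\ forall i, U [set t | c t i = vertex r i].
Proof.
move=> UU cU.
have /choice[l lU] : forall i, exists x, U [set t | c t i = x].
  move=> i; have [s sP] := ball_finite i; apply: (ultra_finite (s := s)).
  apply: filterS (cU i) => t /= [ct0 gct]; apply: sP.
  by rewrite -[X in (_ <= X)%N]subn0 -(gct 0%N i) ?leqnn // ct0.
have l0 : l 0%N = 1.
  by have [t [/= <- [->]]] := proper_meets (lU 0%N) (cU 0%N).
have [|r rl] := @ray_of l.
  move=> n i j ijn.
  have [t [/= [<- <-] [_]]] := proper_meets (filterI (lU i) (lU j)) (cU n).
  exact.
exists r; split; first by rewrite /based rl.
by move=> i; apply: filterS (lU i) => t /= ->; rewrite rl.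
Qed.

Lemma boundary_pointP r s :
  boundary_point r = boundary_point s <->
  exists C : nat, forall i, (d (vertex r i) (vertex s i) <= C)%N.
Proof.
split=> [/eqmodP/asboolP[C rs]|[C rs]]; first by exists C.
by apply/eqmodP/asboolP; exists C.
Qed.

(** As [G] is discrete, rays converge as soon as each vertex is eventually
    constant along [U]; the projection to the boundary is continuous. *)
Lemma boundary_near (T : Type) (U : set_system T) {FU : Filter U}
    (r : T -> geodesic_rays genS) s (A : set (gromov_boundary genS)) :
  (forall i, U [set t | vertex (r t) i = vertex s i]) ->
  nbhs (boundary_point s) A -> U [set t | A (boundary_point (r t))].
Proof.
move=> rs sA.
have vr : (fun t => val (r t)) @ U --> (val s : {ptws nat -> discrete_topology G}).
  apply: ptws_cvg => i W /nbhs_singleton Wi.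
  suff : U [set t | W (vertex (r t) i)] by [].
  by apply: filterS (rs i) => t /= ->.
have [_ [[B oB <-] Bs BA]] : nbhs s ((fun r => boundary_point r) @^-1` A).
  exact: pi_continuous sA.
have /vr UB : nbhs (val s) B by exact: open_nbhs_nbhs.
by apply: filterS (UB : U [set t | B (val (r t))]) => t; exact: BA.
Qed.

Lemma nbhs_vertex (s : geodesic_rays genS) n :
  nbhs s [set r | forall i, (i <= n)%N -> vertex r i = vertex s i].
Proof.
have ns i : nbhs s [set r | vertex r i = vertex s i].
  have nv : nbhs (val s : {ptws nat -> discrete_topology G})
      [set c | c i = vertex s i :> discrete_topology G].
    exact: (@proj_continuous nat (fun=> discrete_topology G) i (val s) _
      (discrete_set1 (vertex s i : discrete_topology G))).
  exact: (@initial_continuous _ _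
    (val : geodesic_rays genS -> {ptws nat -> discrete_topology G}) s _ nv).
elim: n => [|n IHn].
  by apply: filterS (ns 0%N) => r /= r0 i; rewrite leqn0 => /eqP ->.
apply: (filterS _ (filterI IHn (ns n.+1))) => r /= [rn rn1] i.
by rewrite leq_eqVlt ltnS => /predU1P[->//|/rn].
Qed.

End Cayley.

(** * Hyperbolic geometry of the boundary *)

(** Hyperbolicity multiplied by [2] and rearranged, with [D] an integer at
    least [2 delta]; it involves no subtraction. *)
Definition four_point {T : Type} (d : T -> T -> nat) (D : nat) : Prop :=
  forall w x y z,
    (d x z + d y w <= maxn (d x y + d z w) (d y z + d x w) + D)%N.

Lemma gromov_hyperbolic_nat (R : realType) (T : Type) (d : T -> T -> nat) :
  gromov_hyperbolic (fun x y => (d x y)%:R%R : R) -> exists D, four_point d D.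
Proof.
move=> [delta hyp].
have [D hD] : exists D : nat, (2 * delta < D%:R)%R.
  exists (Num.bound `|2 * delta|%R).
  exact: le_lt_trans (ler_norm _) (archi_boundP (normr_ge0 _)).
exists D => w x y z; have := hyp w x y z; rewrite /gromov_product.
rewrite lerBlDr ge_min => /orP[] h.
  suff : (d x z + d y w <= d x y + d z w + D)%N by lia.
  by rewrite -(ler_nat R) !natrD; lra.
suff : (d x z + d y w <= d y z + d x w + D)%N by lia.
by rewrite -(ler_nat R) !natrD; lra.
Qed.

Section Hyperbolic.
Context {G : groupType} {S : seq G} (genS : generates S).
Local Notation d := (cayley_dist genS).
Variables (D : nat) (hypD : four_point d D).

Let dC := cayley_distC genS.
Let tri := cayley_dist_triangle genS.

(** [u] and [v] are at distance [i] from [p] on geodesics from [p] to [x]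
    and to [y]; the last hypothesis says that the Gromov product of [x] and [y]
    at [p] is at least [i], so up to that time the geodesics fellow travel. *)
Lemma fellow_points p u x v y i :
  d p u = i -> d p v = i -> d p x = (i + d u x)%N -> d p y = (i + d v y)%N ->
  (2 * i + d x y <= d p x + d p y)%N -> (d u v <= 2 * D)%N.
Proof.
move=> pu pv px py xy.
have := hypD p u x y; have := hypD p u y v.
by rewrite (dC x p) (dC y p) (dC u p) (dC v p) (dC y v); lia.
Qed.

(** The bound does not depend on the two rays except through their origins;
    uniform bounds of this kind survive passage to the limit. *)
Lemma based_asymptotic_bound (r s : geodesic_rays genS) i :
  based r -> boundary_point r = boundary_point s ->
  (d (vertex r i) (vertex s i) <= d 1 (vertex s 0) + 2 * D)%N.
Proof.
move=> r0 /boundary_pointP[C rs].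
pose n := (i + C + d 1%g (vertex s 0%N))%N.
have := hypD 1 (vertex r i) (vertex r n) (vertex s n).
have := hypD 1 (vertex r i) (vertex s n) (vertex s i).
have := rs n; have := tri 1 (vertex s 0%N) (vertex s n).
have := tri (vertex s 0%N) 1 (vertex s i).
rewrite (dC (vertex r n) 1) (dC (vertex s n) 1) (dC (vertex r i) 1) (dC (vertex s i) 1).
rewrite !(based_dist _ r0) (dC (vertex s n) (vertex s i)) (dC (vertex s 0%N) 1).
by rewrite !vertex_dist /n; lia.
Qed.

(** The ray is a limit of segments from [1] to the vertices of [s]. *)
Lemma based_ray_ex (s : geodesic_rays genS) :
  exists r, based r /\ boundary_point r = boundary_point s.
Proof.
have [U [UU nU]] := ultraFilterLemma eventually_filter.
have /choice[c hc] := fun n => segment_ex genS (vertex s n).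
have large m : U [set n | m <= d 1 (vertex s n)]%N.
  apply: nU; exists (m + d 1%g (vertex s 0%N))%N => // n /= mn.
  have := tri 1 (vertex s 0%N) (vertex s n).
  by rewrite vertex_dist // (dC _ 1) subn0; lia.
have [|r [r0 rU]] := @ultralimit_ray _ _ genS _ U c UU.
  move=> m; apply: filterS (large m) => n /= mn.
  have [c0 cn gc] := hc n; split=> // i j /andP[ij jm]; apply: gc.
  by rewrite ij (leq_trans jm).
exists r; split=> //; apply/boundary_pointP; exists (d 1 (vertex s 0) + D)%N => i.
have Ui : U [set n | i <= n]%N by apply: nU; exists i.
have [n [/= [rn ni] nn]] := proper_meets (filterI (rU i) Ui) (large i).
have [ci cin] := segment_dist (hc n) nn.
have := hypD 1 (vertex s i) (vertex s n) (c n i).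
have := tri 1 (vertex s 0%N) (vertex s n); have := tri (vertex s 0%N) 1 (vertex s i).
rewrite -rn (dC (vertex s n) 1) (dC (c n i) 1) (dC (vertex s i) 1).
rewrite (dC (vertex s n) (c n i)) ci cin (dC (c n i) (vertex s i)) (dC (vertex s 0%N) 1).
by rewrite !vertex_dist //; lia.
Qed.

Lemma based_representatives : exists rep : gromov_boundary genS -> geodesic_rays genS,
  forall x, based (rep x) /\ boundary_point (rep x) = x.
Proof.
suff /choice[rep hrep] : forall x : gromov_boundary genS,
    exists r : geodesic_rays genS, based r /\ boundary_point r = x by exists rep.
move=> x; have [r [r0 rx]] := based_ray_ex (repr x).
by exists r; split=> //; rewrite rx; exact: reprK.
Qed.

Lemma based_ultralimit (T : Type) (U : set_system T) (r : T -> geodesic_rays genS) :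
  UltraFilter U -> (forall t, based (r t)) ->
  exists s : geodesic_rays genS,
    based s /\ forall i, U [set t | vertex (r t) i = vertex s i].
Proof.
move=> UU r0; apply: (@ultralimit_ray _ _ genS _ U (fun t => vertex (r t))) => n.
by apply: nearW => t; split; [exact: r0|move=> i j /andP[ij _]; exact: vertex_dist].
Qed.

(** The source of the Hausdorff property.  The topology of the boundary uses
    rays of all origins; the uniform bound on asymptotic rays lets rays from [1]
    converge together with asymptotic rays of other origins. *)
Lemma closed_through k v : closed [set x : gromov_boundary genS |
  exists r : geodesic_rays genS, [/\ based r, vertex r k = v & boundary_point r = x]].
Proof.
set C := [set x | _].
suff cC : closed ((fun r => boundary_point r) @^-1` C : set (geodesic_rays genS)).
  by rewrite -openC /open /= /quotient_open preimage_setC openC.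
move=> s sC.
have /choice[r hr] : forall n, exists r : geodesic_rays genS,
    [/\ based r, vertex r k = v &
    forall i, (i <= n)%N -> (d (vertex r i) (vertex s i) <= d 1 (vertex s 0) + 2 * D)%N].
  move=> n; have [s' [[r [r0 rk rs']] s's]] := sC _ (nbhs_vertex s n).
  exists r; split=> // i ni; rewrite -(s's i ni) -(s's 0%N) //.
  exact: based_asymptotic_bound.
have [U [UU nU]] := ultraFilterLemma eventually_filter.
have [|r' [r'0 r'U]] := @based_ultralimit _ U r UU; first by move=> n; have [] := hr n.
exists r'; split=> //.
  have [n [/= <- _]] := proper_meets (r'U k) (r'U k).
  by have [] := hr n.
apply/boundary_pointP; exists (d 1 (vertex s 0) + 2 * D)%N => i.
have Ui : U [set n | i <= n]%N by apply: nU; exists i.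
have [n [/= <- ni]] := proper_meets (r'U i) Ui.
by have [_ _] := hr n; exact.
Qed.

(** It suffices that every limit [p] of an ultrafilter be represented by the
    limit [s] of the rays from [1].  By closedness, [p] has for each [k] a
    representative from [1] through the [k]-th vertex of [s]; so its fixed
    representative stays within [2 * D] of [s]. *)
Lemma boundary_hausdorff : hausdorff_space (gromov_boundary genS).
Proof.
have [rep hrep] := based_representatives.
suff lim U (s : geodesic_rays genS) : UltraFilter U -> based s ->
    (forall i, U [set x | vertex (rep x) i = vertex s i]) ->
    forall p, U --> p -> p = boundary_point s.
  move=> p q; rewrite cluster_cvgE => -[F PF [Fq pF]].
  have [U [UU FU]] := ultraFilterLemma PF.
  have [|s [s0 sU]] := @based_ultralimit _ U rep UU; first by move=> x; have [] := hrep x.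
  rewrite (lim U s UU s0 sU p); last exact: subset_trans pF FU.
  by rewrite (lim U s UU s0 sU q) //; exact: subset_trans Fq FU.
move=> UU s0 sU p Up.
have [p0 pE] := hrep p.
rewrite -pE; apply/boundary_pointP; exists (2 * D)%N => k.
have := @closed_through k (vertex s k); rewrite closedE => /(_ p)[|r [r0 rk rp]].
  move=> /Up Uk; have [x [/= xk]] := proper_meets (sU k) Uk.
  by apply; exists (rep x); have [] := hrep x.
have := @based_asymptotic_bound (rep p) r k p0 (etrans pE (esym rp)).
by rewrite r0 cayley_distxx rk.
Qed.

Lemma boundary_compact : compact [set: gromov_boundary genS].
Proof.
have [rep hrep] := based_representatives.
rewrite compact_ultra => U UU _.
have [|s [s0 sU]] := @based_ultralimit _ U rep UU; first by move=> x; have [] := hrep x.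
exists (boundary_point s); split=> // A /(boundary_near sU) /= UA.
by apply: filterS UA => x /=; have [_ ->] := hrep x.
Qed.

Lemma boundary_act_continuous g : continuous (boundary_act genS g).
Proof.
apply/quotient_continuous => r.
have -> : boundary_act genS g \o \pi_(gromov_boundary genS)%qT =
          (fun s => boundary_point (translate g s)).
  by apply/funext => s; exact: boundary_actE.
move=> A; apply: boundary_near => i; apply: filterS (nbhs_vertex r i) => s /= rs.
by rewrite !vertex_translate rs.
Qed.


Lemma geodesic_segments : exists c : G -> nat -> G,
  forall g, segment_to genS g (c g).
Proof. by have /choice[c hc] := segment_ex genS; exists c. Qed.

Lemma dist1V g : d 1 g^-1 = d 1 g.
Proof. by have := cayley_distM genS g 1 g^-1; rewrite mulg1 mulgV dC => <-. Qed.

Lemma segment_ultralimit (T : Type) (U : set_system T) (g : T -> G) c :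
  UltraFilter U -> (forall n, U [set t | n <= d 1 (g t)]%N) ->
  (forall h, segment_to genS h (c h)) ->
  exists r : geodesic_rays genS,
    based r /\ forall i, U [set t | c (g t) i = vertex r i].
Proof.
move=> UU gU hc; apply: (@ultralimit_ray _ _ genS _ U (fun t => c (g t)) UU) => n.
apply: filterS (gU n) => t /= nt; have [c0 _ gc] := hc (g t).
by split=> // i j /andP[ij jn]; apply: gc; rewrite ij (leq_trans jn).
Qed.

(** In terms of Gromov products: as [r] leaves the segment to [g^-1] before
    time [k], the product at [1] of [g] and a far vertex of [g r] is at least
    [d 1 g - k]; far vertices of [s] and [g r] are close to each other, so the
    product of [g] and a far vertex of [s] is almost as large. *)
Lemma far_ray_follows g (r s : geodesic_rays genS) c k i :
  based r -> based s -> (2 * D < d (vertex r k) (c g^-1 k))%N ->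
  (forall h, segment_to genS h (c h)) ->
  boundary_point s = boundary_act genS g (boundary_point r) ->
  (i + k + D <= d 1 g)%N ->
  (d (vertex s i) (c g i) <= 2 * D)%N.
Proof.
move=> r0 s0 rk hc; rewrite boundary_actE => /boundary_pointP[C sC] large.
(* A time beyond which the distance between [s] and [g r], at most [C], no
   longer matters for Gromov products at [1]. *)
pose j := (i + k + C + d 1%g g)%N.
have ck : (k <= d 1 g^-1)%N by rewrite dist1V; lia.
have [ck1 ckg] := segment_dist (hc g^-1) ck.
have ci : (i <= d 1 g)%N by lia.
have [ci1 cig] := segment_dist (hc g) ci.
have sj : d 1 (vertex s j) = j by exact: based_dist.
have rj : d 1 (vertex r j) = j by exact: based_dist.
have jk : (k <= j)%N by rewrite /j; lia.
have ji : (i <= j)%N by rewrite /j; lia.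
have Cj : (C + d 1 g <= j)%N by rewrite /j; lia.
have far : (j + d 1 g < 2 * k + d (vertex r j) g^-1)%N.
  rewrite ltnNge; apply/negP => near_; move: rk; rewrite ltnNge => /negP; apply.
  apply: (@fellow_points 1 (vertex r k) (vertex r j) (c g^-1 k) g^-1 k).
  - exact: based_dist.
  - by [].
  - by rewrite vertex_dist // rj; lia.
  - by rewrite ckg subnKC.
  - by rewrite rj dist1V.
have rg : d (g * vertex r j) 1 = d (vertex r j) g^-1.
  by rewrite -(cayley_distM genS g (vertex r j) g^-1) mulgV.
have gr : d (g * vertex r j) g = j.
  by rewrite -{2}(mulg1 g) cayley_distM dC.
have sr : (d (vertex s j) (g * vertex r j) <= C)%N := sC j.
have := hypD 1 (vertex s j) (g * vertex r j) g => hyp.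
apply: (@fellow_points 1 (vertex s i) (vertex s j) (c g i) g i).
- exact: based_dist.
- by [].
- by rewrite vertex_dist // sj; lia.
- by rewrite cig subnKC.
- by move: hyp; rewrite rg (dC g 1) gr (dC (vertex s j) 1) sj; lia.
Qed.

(** Were it false, ultrafilter-many [g] would have a point [x g] outside [V]
    with image outside [W].  Let [t] be the limit of rays towards [x g].
    Either [t] is asymptotic to [s], and [x g] enters [V]; or [t] leaves [s],
    so do the nearby rays, and [far_ray_follows] brings the images into [W]. *)
Lemma collapses_of_segments (U : set_system G) c (r s : geodesic_rays genS) :
  UltraFilter U -> (forall n, U [set g | n <= d 1 g]%N) ->
  (forall h, segment_to genS h (c h)) ->
  based r -> (forall i, U [set g | c g i = vertex r i]) ->
  based s -> (forall i, U [set g | c g^-1 i = vertex s i]) ->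
  collapses (boundary_act genS) U (boundary_point r) (boundary_point s).
Proof.
move=> UU gU hc r0 rU s0 sU W V rW sV.
have [//|/= Ubad] := in_ultra_setVsetC
  [set g | forall x, ~ V x -> W (boundary_act genS g x)] UU.
exfalso.
have [rep hrep] := based_representatives.
have /choice[x xP] : forall g : G, exists x,
    ~ (forall x, ~ V x -> W (boundary_act genS g x)) ->
    ~ V x /\ ~ W (boundary_act genS g x).
  move=> g; have [good|/existsNP[x /not_implyP bad]] :=
    pselect (forall x, ~ V x -> W (boundary_act genS g x)).
    by exists (boundary_point r).
  by exists x.
have [|t [t0 tU]] := @based_ultralimit _ U (fun g => rep (x g)) UU.
  by move=> g; have [] := hrep (x g).
have [|u [u0 uU]] :=
    @based_ultralimit _ U (fun g => rep (boundary_act genS g (x g))) UU.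
  by move=> g; have [] := hrep (boundary_act genS g (x g)).
have [ts|ts] := pselect (boundary_point t = boundary_point s).
  move: sV; rewrite -ts => /(boundary_near tU) UV.
  have [g [/= /xP[Vg _]]] := proper_meets Ubad UV.
  by have [_ ->] := hrep (x g).
have ur : boundary_point u = boundary_point r.
  have [k tsk] : exists k, ~ (d (vertex t k) (vertex s k) <= 2 * D)%N.
    by apply/existsNP => tsD; apply/ts/boundary_pointP; exists (2 * D)%N.
  apply/boundary_pointP; exists (2 * D)%N => i.
  have [g [/= [[tk sk] [ui ri]] large]] := proper_meets
    (filterI (filterI (tU k) (sU k)) (filterI (uU i) (rU i))) (gU (i + k + D)%N).
  have [b0 bx] := hrep (x g).
  have [a0 ax] := hrep (boundary_act genS g (x g)).
  rewrite -ui -ri; apply: (far_ray_follows b0 a0 (k := k)) => //.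
    by rewrite tk sk ltnNge; apply/negP.
  by rewrite ax bx.
move: rW; rewrite -ur => /(boundary_near uU) UW.
have [g [/= /xP[_ Wg]]] := proper_meets Ubad UW.
by have [_ ->] := hrep (boundary_act genS g (x g)).
Qed.

Lemma segment_to_ray (U : set_system G) c (r s : geodesic_rays genS) :
  UltraFilter U ->
  (forall h, segment_to genS h (c h)) ->
  vertex r @ \oo `<=` U -> based r ->
  based s -> (forall i, U [set g | c g i = vertex s i]) ->
  boundary_point s = boundary_point r.
Proof.
move=> UU hc rU r0 s0 sU; apply/boundary_pointP; exists (2 * D)%N => i.
have Ui : U [set g | exists2 n, (i <= n)%N & g = vertex r n].
  by apply: rU; exists i => // n /= ni; exists n.
have [g [/= si [n ni gr]]] := proper_meets (sU i) Ui.
have rn := based_dist n r0; have := ni; rewrite -{1}rn => /(segment_dist (hc _))[ci cig].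
rewrite -si gr.
apply: (@fellow_points 1 _ (vertex r n) _ (vertex r n) i).
- by [].
- exact: based_dist.
- by rewrite cig subnKC // rn.
- by rewrite vertex_dist // rn; lia.
- by rewrite cayley_distxx rn; lia.
Qed.

(** Take an ultrafilter of group elements running along a ray towards [z]. *)
Lemma attracted_everywhere (z : gromov_boundary genS) : exists U e,
  ProperFilter U /\ collapses (boundary_act genS) U z e.
Proof.
have [c hc] := geodesic_segments.
have [rep hrep] := based_representatives; have [r0 rz] := hrep z.
have [U [UU rU]] :=
  ultraFilterLemma (fmap_proper_filter (vertex (rep z)) eventually_filter).
have large n : U [set g | n <= d 1 g]%N.
  by apply: rU; exists n => // m /= nm; rewrite based_dist.
have large' n : U [set g | n <= d 1 g^-1]%N.
  by apply: filterS (large n) => g /=; rewrite dist1V.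
have [a [a0 aU]] := segment_ultralimit UU large hc.
have [b [b0 bU]] := segment_ultralimit UU large' hc.
exists U, (boundary_point b); split; first exact: ultra_proper.
rewrite -rz -(segment_to_ray UU hc rU r0 a0 aU).
exact: collapses_of_segments UU large hc a0 aU b0 bU.
Qed.

(** An injective sequence leaves every finite ball, hence tends to infinity
    along any ultrafilter containing its tails. *)
Lemma injective_sequence_collapses (g : nat -> G) : injective g ->
  exists U a b, [/\ ProperFilter U, g @ \oo `<=` U &
    collapses (boundary_act genS) U a b].
Proof.
move=> ginj; have [c hc] := geodesic_segments.
have [U [UU gU]] := ultraFilterLemma (fmap_proper_filter g eventually_filter).
have large n : U [set h | n <= d 1 h]%N.
  have [//|/= Usmall] := in_ultra_setVsetC [set h | n <= d 1 h]%N UU.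
  exfalso; have [s sP] := ball_finite genS n.
  have Us : U [set h | h \in s].
    by apply: filterS Usmall => h /= /negP; rewrite -ltnNge => /ltnW /sP.
  have [h Uh] := ultra_finite UU (f := id) Us.
  have Unh : U [set x | x <> h].
    apply: gU; have [[m mh]|noh] := pselect (exists m, g m = h); last first.
      by exists 0%N => // m _ mh; apply: noh; exists m.
    by exists m.+1 => // k /= mk; rewrite -mh => /ginj km; move: mk; rewrite km ltnn.
  by have [x []] := proper_meets Uh Unh.
have large' n : U [set h | n <= d 1 h^-1]%N.
  by apply: filterS (large n) => h /=; rewrite dist1V.
have [a [a0 aU]] := segment_ultralimit UU large hc.
have [b [b0 bU]] := segment_ultralimit UU large' hc.
exists U, (boundary_point a), (boundary_point b); split; [exact: ultra_proper|by []|].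
exact: collapses_of_segments UU large hc a0 aU b0 bU.
Qed.

End Hyperbolic.

Lemma boundary_act1 (G : groupType) (S : seq G) (genS : generates S) x :
  boundary_act genS 1 x = x.
Proof.
have [r <-] : exists r, boundary_point r = x by exists (repr x); exact: reprK.
rewrite boundary_actE; apply/boundary_pointP; exists 0%N => i.
by rewrite vertex_translate mul1g cayley_distxx.
Qed.

Lemma boundary_actM (G : groupType) (S : seq G) (genS : generates S) g h x :
  boundary_act genS (g * h) x = boundary_act genS g (boundary_act genS h x).
Proof.
have [r <-] : exists r, boundary_point r = x by exists (repr x); exact: reprK.
rewrite !boundary_actE; apply/boundary_pointP; exists 0%N => i.
by rewrite !vertex_translate mulgA cayley_distxx.
Qed.

Theorem corollary6p6 (R : realType) (G : groupType) (S : seq G)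
    (genS : generates S) (hypG : hyperbolic_group genS R) :
  tame (boundary_act genS) R /\
  (non_elementary genS -> ~ tame1 (boundary_act genS)).
Proof.
have [D hypD] := gromov_hyperbolic_nat hypG; split.
  apply: convergence_action_tame => g; first exact: boundary_act_continuous.
  exact (injective_sequence_collapses hypD (g := g)).
move=> [x [y [z [xy yz xz]]]].
apply: convergence_action_not_tame1 xy yz xz.
- exact: boundary_hausdorff hypD.
- exact: boundary_compact hypD.
- exact: boundary_act1.
- exact: boundary_actM.
- exact: boundary_act_continuous.
- exact: attracted_everywhere hypD.
Qed.
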